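(* Let $A$ be a commutative ring, $\mathbf f=(f_1,f_2):\{1,\dots,m\}\to\mathbb N^2$ with $f_1\equiv1$, and $M$ a finitely generated bigraded $A[\mathbf f]$-module whose homogeneous components $M_{n,d}$ are all $A$-modules of finite length. Then there exist an integer $h\ge0$ and Laurent polynomials $I_\alpha\in\mathbb Z[X,Y,X^{-1},Y^{-1}]$, indexed by subsets $\alpha\subseteq\{1,\dots,m\}$ with $\#\alpha\le h$, such that $$P_M(X,Y)=\sum_{r=0}^h\sum_{\#\alpha=r}I_\alpha(X,Y)\prod_{i\in\alpha}(1-XY^{f_2(i)})^{-1},$$ the coefficients of $I_\alpha$ are nonnegative whenever $\#\alpha=h$, and, if $M\ne0$, $I_\alpha\neq0$ for at least one $\alpha$ with $\#\alpha=h$.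
   Context: $A[\mathbf f]$ is the polynomial ring $A[T_1,\dots,T_m]$ with the $\mathbb N^2$-grading in which $T_i$ is homogeneous of bidegree $\mathbf f(i)$. A bigraded $A[\mathbf f]$-module is an $A[\mathbf f]$-module $M=\bigoplus_{(n,d)\in\mathbb Z^2}M_{n,d}$ with $A[\mathbf f]_{(n,d)}M_{(n',d')}\subseteq M_{(n+n',d+d')}$. Its Poincaré series is $P_M=\sum_{(n,d)\in\mathbb Z^2}\mathrm{len}_A(M_{n,d})X^nY^d\in\mathbb Z[[X,Y]][X^{-1},Y^{-1}]$, and $(1-XY^e)^{-1}=\sum_{k\ge0}X^kY^{ke}$. *)

(* Defs.v *)
From HB Require Import structures.
From mathcomp Require Import all_boot all_order all_algebra.
Set Implicit Arguments. Unset Strict Implicit. Unset Printing Implicit Defensive.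
Import Order.TTheory GRing.Theory Num.Theory.
Local Open Scope ring_scope.

Section Length.
Variables (A : comPzRingType) (M : lmodType A).

Definition is_submod (S : M -> Prop) : Prop :=
  [/\ S 0, (forall x y, S x -> S y -> S (x + y)) & (forall (a : A) x, S x -> S (a *: x))].

Definition sub_incl (S S' : M -> Prop) : Prop := forall x, S x -> S' x.
Definition strict_incl (S S' : M -> Prop) : Prop :=
  sub_incl S S' /\ exists x, S' x /\ ~ S x.

Definition has_chain (S : M -> Prop) (n : nat) : Prop :=
  exists C : nat -> M -> Prop,
    (forall k, (k <= n)%N -> is_submod (C k) /\ sub_incl (C k) S) /\
    (forall k, (k < n)%N -> strict_incl (C k) (C k.+1)).

Definition has_length (S : M -> Prop) (n : nat) : Prop :=
  has_chain S n /\ ~ has_chain S n.+1.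

End Length.

Section Bigraded.
Variables (A : comPzRingType) (M : lmodType A) (m : nat).

(* T i is the action of the variable T_i : an A-linear endomorphism *)
Definition lin_endo (t : M -> M) : Prop :=
  forall (a : A) x y, t (a *: x + y) = a *: t x + t y.

(* M = (+)_{(n,d) in Z^2} H n d as A-modules, and T_i (homogeneous of
   bidegree (1, f2 i)) maps H n d into H (n+1) (d + f2 i). *)
Definition bigraded (f2 : 'I_m -> nat) (T : 'I_m -> M -> M)
    (H : int -> int -> M -> Prop) : Prop :=
  [/\ (forall n d, is_submod (H n d)),
      (forall x : M, exists s : seq ((int * int) * M),
          [/\ uniq [seq p.1 | p <- s],
              (forall p, p \in s -> H p.1.1 p.1.2 p.2) &
              x = \sum_(p <- s) p.2]),
      (forall s : seq ((int * int) * M),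
          uniq [seq p.1 | p <- s] ->
          (forall p, p \in s -> H p.1.1 p.1.2 p.2) ->
          \sum_(p <- s) p.2 = 0 -> forall p, p \in s -> p.2 = 0) &
      (forall i n d x, H n d x -> H (n + 1) (d + (f2 i)%:Z) (T i x))].

Inductive generated (T : 'I_m -> M -> M) (gs : seq M) : M -> Prop :=
  | gen_base x : x \in gs -> generated T gs x
  | gen_zero : generated T gs 0
  | gen_add x y : generated T gs x -> generated T gs y -> generated T gs (x + y)
  | gen_scale (a : A) x : generated T gs x -> generated T gs (a *: x)
  | gen_T i x : generated T gs x -> generated T gs (T i x).

Definition fin_gen (T : 'I_m -> M -> M) : Prop :=
  exists gs : seq M, forall x, generated T gs x.

End Bigraded.

(* coefficient of X^t Y^e in prod_{i in al} (1 - X Y^{f2 i})^{-1}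
   = prod_{i in al} sum_{k>=0} X^k Y^{k f2 i}
   = #{ k : 'I_m -> nat supported on al | sum k = t, sum k_i f2 i = e } *)
Definition geomcoef (m : nat) (f2 : 'I_m -> nat) (al : {set 'I_m}) (t e : int) : nat :=
  match t with
  | Posz t' =>
      #|[set k : {ffun 'I_m -> 'I_t'.+1} |
          [&& [forall i, (i \notin al) ==> (nat_of_ord (k i) == 0%N)],
              (\sum_i nat_of_ord (k i))%N == t' &
              ((\sum_i (nat_of_ord (k i) * f2 i))%N)%:Z == e]]|
  | Negz _ => 0%N
  end.

(* coefficient of X^n Y^d in
     sum_{#al <= h} I_al(X,Y) prod_{i in al} (1 - X Y^{f2 i})^{-1},
   where each Laurent polynomial I_al has coefficient I al a b at X^a Y^b,
   supported in [-N, N]^2 *)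
Definition poinc_rhs (m : nat) (f2 : 'I_m -> nat) (h N : nat)
    (I : {set 'I_m} -> int -> int -> int) (n d : int) : int :=
  \sum_(al : {set 'I_m} | (#|al| <= h)%N)
    \sum_(i < (N.*2).+1) \sum_(j < (N.*2).+1)
      I al (i%:Z - N%:Z) (j%:Z - N%:Z) *
      (geomcoef f2 al (n - (i%:Z - N%:Z)) (d - (j%:Z - N%:Z)))%:Z.

(* Main.v *)
(** Pick homogeneous generators [x_e] and order the monomial multiples
    [T^mu x_e] lexicographically, first by [e] and then by [mu].  Inside one
    bidegree the spans of initial segments filter [M_{n,d}] by [A]-submodules
    with cyclic quotients; let [l_e(mu)] be the length of the quotient at
    [T^mu x_e].  As the order is compatible with multiplication, [T^rho] induces
    a surjection from the quotient at [mu] onto the one at [mu + rho], so [l_e]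
    is antitone, and [len M_{n,d}] is the sum of the [l_e(mu)] over the
    [T^mu x_e] of bidegree [(n,d)].  An antitone function [N^m -> N] is a finite
    sum of indicator functions of Stanley boxes [rho + N^al], and each box
    contributes a monomial times [prod_(i in al) (1 - X Y^(f2 i))^-1].  Thus all
    the [I_al] can be taken with nonnegative coefficients, and [h] is the largest
    size of an [al] that occurs. *)

Require Import Defs.
From HB Require Import structures.
From mathcomp Require Import all_boot all_order all_algebra.
From mathcomp Require Import boolp zify.
Import Order.TTheory GRing.Theory Num.Theory.
Local Open Scope ring_scope.
Set Implicit Arguments.
Unset Strict Implicit.
Unset Printing Implicit Defensive.

(** * Relative length of nested submodules, measured by chains *)

Section RelativeLength.
Variables (A : comPzRingType) (M : lmodType A).
Implicit Types (N P Q S : M -> Prop) (x y : M).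

Definition sub_add P Q x := exists y z, [/\ P y, Q z & x = y + z].
Definition sub_cap P Q x := P x /\ Q x.
Definition sub_zero x := x = 0.

Lemma is_submod_zero : is_submod sub_zero.
Proof.
split=> // [x y -> ->|a x ->]; first by rewrite /sub_zero addr0.
by rewrite /sub_zero scaler0.
Qed.

Lemma is_submod_add P Q : is_submod P -> is_submod Q -> is_submod (sub_add P Q).
Proof.
move=> [P0 PD PZ] [Q0 QD QZ]; split.
- by exists 0, 0; split; rewrite ?addr0.
- move=> _ _ [a [b [Pa Qb ->]]] [c [d [Pc Qd ->]]].
  by exists (a + c), (b + d); split; [exact: PD|exact: QD|rewrite addrACA].
- move=> k _ [a [b [Pa Qb ->]]].
  by exists (k *: a), (k *: b); split; [exact: PZ|exact: QZ|rewrite scalerDr].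
Qed.

Lemma is_submod_cap P Q : is_submod P -> is_submod Q -> is_submod (sub_cap P Q).
Proof.
move=> [P0 PD PZ] [Q0 QD QZ]; split=> //.
- by move=> x y [Px Qx] [Py Qy]; split; [exact: PD|exact: QD].
- by move=> k x [Px Qx]; split; [exact: PZ|exact: QZ].
Qed.

Lemma is_submodN P x : is_submod P -> P x -> P (- x).
Proof. by move=> [_ _ PZ] Px; rewrite -scaleN1r; apply: PZ. Qed.

Lemma is_submodB P x y : is_submod P -> P x -> P y -> P (x - y).
Proof. by move=> sP Px Py; case: (sP) => _ PD _; apply: PD => //; apply: is_submodN. Qed.

(** Strict chains above [N] and inside [S], standing for chains in the quotient of [S] by [N]
    without forming it. The bottom member may be any submodule containing [N], which makes it easy
    to shrink [N] or enlarge [S]. *)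
Inductive rchain N : (M -> Prop) -> nat -> Prop :=
| rchain0 S : is_submod S -> sub_incl N S -> rchain N S 0
| rchainS P S n : rchain N P n -> is_submod S -> strict_incl P S ->
    rchain N S n.+1.

Lemma rchain_incl N S n : rchain N S n -> sub_incl N S.
Proof. by elim=> // P {}S {}n _ NP _ [PS _] x /NP/PS. Qed.

Lemma rchain_submod N S n : rchain N S n -> is_submod S.
Proof. by case. Qed.

Lemma rchain_widen N P S n :
  rchain N P n -> is_submod S -> sub_incl P S -> rchain N S n.
Proof.
move=> c sS; case: c => [{}P _ NP PS|Q {}P {}n c _ [QP [x [Px nQx]]] PS].
  by apply: rchain0 => // x /NP/PS.
apply: rchainS c sS _; split; first by move=> z /QP/PS.
by exists x; split=> //; apply: PS.
Qed.

Lemma rchain_leq N S n k : rchain N S n -> (k <= n)%N -> rchain N S k.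
Proof.
elim=> [{}S sS NS|P {}S {}n c IH sS [PS ex]].
  by rewrite leqn0 => /eqP ->; apply: rchain0.
rewrite leq_eqVlt => /predU1P[->|lt_kn]; first exact: rchainS c sS _.
exact: rchain_widen (IH lt_kn) sS PS.
Qed.

Lemma has_chainE S n : is_submod S -> has_chain S n <-> rchain sub_zero S n.
Proof.
move=> sS; split=> [[C [Cs Cst]]|].
  suff /(_ n (leqnn n)) c : forall k, (k <= n)%N -> rchain sub_zero (C k) k.
    by have [_ CS] := Cs n (leqnn n); apply: rchain_widen c sS CS.
  elim=> [_|k IH lt_kn].
    by have [sC _] := Cs 0 isT; apply: rchain0 => // x ->; case: sC.
  have [sC _] := Cs _ lt_kn.
  exact: rchainS (IH (ltnW lt_kn)) sC (Cst _ lt_kn).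
move: sS => _; elim=> [{}S sS _|P {}S {}n _ [C [Cs Cst]] sS [PS [x [Sx nPx]]]].
  by exists (fun _ => S); split=> // k _; split.
exists (fun k => if (k <= n)%N then C k else S); split=> k.
  case: ifP => [kn _|_ _]; last by split.
  by have [sC CP] := Cs k kn; split=> // z /CP/PS.
rewrite ltnS => kn; rewrite kn; case: ifP => [/Cst//|/negbT].
rewrite -leqNgt => nk; have {nk} -> : k = n by apply/eqP; rewrite eqn_leq kn.
have [_ CP] := Cs n (leqnn n).
by split=> [z /CP/PS//|]; exists x; split=> // /CP.
Qed.

Lemma rchain_cat N P S a b :
  rchain N P a -> rchain P S b -> rchain N S (a + b).
Proof.
move=> c; elim=> [{}S sS PS|Q {}S {}b _ IH sS QS].
  by rewrite addn0; apply: rchain_widen c sS PS.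
by rewrite addnS; apply: rchainS IH sS QS.
Qed.

(* Modular law: a strict inclusion stays strict either after intersecting
   with [P] or after adding [P]. *)
Lemma rchain_split N P S n : is_submod P -> sub_incl N P -> rchain N S n ->
  exists a b, [/\ (n <= a + b)%N, rchain N (sub_cap S P) a &
                 rchain P (sub_add S P) b].
Proof.
move=> sP NP; have [P0 PD _] := sP.
elim=> [{}S sS NS|Q {}S {}n cQ [a [b [le_n ca cb]]] sS [QS [x [Sx nQx]]]].
  exists 0%N, 0%N; split=> //; first by apply: rchain0; [exact: is_submod_cap|split; auto].
  apply: rchain0; first exact: is_submod_add.
  by move=> x Px; exists 0, x; split; rewrite ?add0r //; case: sS.
have sQ := rchain_submod cQ.
have sc : is_submod (sub_cap S P) by exact: is_submod_cap.
have sa : is_submod (sub_add S P) by exact: is_submod_add.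
have QSc : sub_incl (sub_cap Q P) (sub_cap S P) by move=> z [/QS].
have QSa : sub_incl (sub_add Q P) (sub_add S P).
  by move=> _ [y [z [/QS Sy Pz ->]]]; exists y, z.
have [[y [z [Qy Pz xE]]]|nx] := pselect (sub_add Q P x); last first.
  exists a, b.+1; split; rewrite ?addnS //; first exact: rchain_widen ca sc QSc.
  apply: rchainS cb sa _; split=> //; exists x; split=> //.
  by exists x, 0; rewrite addr0.
exists a.+1, b; split=> //; last exact: rchain_widen cb sa QSa.
have zE : z = x - y by rewrite xE addrC addKr.
apply: rchainS ca sc _; split=> //; exists z; split.
  by split=> //; rewrite zE; apply: is_submodB => //; apply: QS.
by case=> Qz _; apply: nQx; rewrite xE; case: sQ => _ QD _; apply: QD.
Qed.

Lemma rchain_split_incl N P S n :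
  is_submod P -> is_submod S -> sub_incl N P -> sub_incl P S -> rchain N S n ->
  exists a b, [/\ (n <= a + b)%N, rchain N P a & rchain P S b].
Proof.
move=> sP sS NP PS /(rchain_split sP NP) [a [b [le_n ca cb]]].
exists a, b; split=> //; first by apply: rchain_widen ca sP _ => x [].
apply: (rchain_widen cb sS) => _ [x [y [Sx /PS Sy ->]]].
by case: sS => _ SD _; apply: SD.
Qed.

(** A chain is pulled back along [t] and intersected with [S]. Strictness survives because every
    element of [S'] agrees modulo [N'] with [t y] for some [y] in [S]. This is how a surjection
    between quotients bounds lengths. *)
Lemma rchain_preim (t : M -> M) N S N' S' n :
  lin_endo t -> is_submod N -> is_submod S -> is_submod N' -> sub_incl N S ->
  (forall x, N x -> N' (t x)) ->
  (forall x, S' x -> exists2 y, S y & N' (x - t y)) ->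
  rchain N' S' n -> rchain N S n.
Proof.
move=> tlin sN sS sN' NS tN tS c.
have t0 : t 0 = 0 by have := tlin (-1) 0 0; rewrite !scaleN1r !addNr.
have tD x y : t (x + y) = t x + t y by have := tlin 1 x y; rewrite !scale1r.
have tZ a x : t (a *: x) = a *: t x by have := tlin a x 0; rewrite !addr0 t0 addr0.
have sP P : is_submod P -> is_submod (fun z => S z /\ P (t z)).
  move: sS => [S0 SD SZ] [P0 PD PZ]; split; first by rewrite t0.
    by move=> x y [? ?] [? ?]; split; [exact: SD|rewrite tD; exact: PD].
  by move=> a x [? ?]; split; [exact: SZ|rewrite tZ; exact: PZ].
suff: rchain N (fun z => S z /\ S' (t z)) n.
  by move/rchain_widen; apply => // z [].
elim: c tS => [P sP' NP _|P Q {}n c IH sQ [PQ [x [Qx nPx]]] tS].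
  by apply: rchain0; [exact: sP|move=> x Nx; split; [exact: NS|exact/NP/tN]].
have N'P := rchain_incl c; have sP' := rchain_submod c.
apply: rchainS (IH _) _ _; first by move=> z /PQ/tS.
  exact: sP.
split; first by move=> z [Sz /PQ].
(* The lift [y] of the strictness witness [x] separates the two preimages, since [x - t y] lies in
   [N'] and hence in [P] and in [Q]. *)
have [y Sy Nxy] := tS x Qx; exists y; split; first split=> //.
  rewrite -(subKr x (t y)); apply: is_submodB => //; exact/PQ/N'P.
case=> _ Pty; apply: nPx; rewrite -(subrK (t y) x).
by case: (sP') => _ PD _; apply: PD => //; apply: N'P.
Qed.

Definition rfinite N S := exists n, ~ rchain N S n.

Lemma rlen_ex N S : rfinite N S -> is_submod S -> sub_incl N S ->
  exists n, rchain N S n /\ ~ rchain N S n.+1.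
Proof.
move=> [n nc] sS NS; elim: n nc => [[]|n IH nc]; first exact: rchain0.
by have [c|/IH//] := pselect (rchain N S n); exists n.
Qed.

(* Junk value [0] when the chains are unbounded. *)
Definition rlen N S : nat :=
  if pselect (exists n, rchain N S n /\ ~ rchain N S n.+1) is left e
  then projT1 (cid e) else 0.

Lemma rlenP N S : rfinite N S -> is_submod S -> sub_incl N S ->
  rchain N S (rlen N S) /\ ~ rchain N S (rlen N S).+1.
Proof.
move=> fin sS NS; rewrite /rlen; case: pselect => [e|[]]; last exact: rlen_ex.
by case: cid.
Qed.

Lemma rlen_ge N S n : rfinite N S -> rchain N S n -> (n <= rlen N S)%N.
Proof.
move=> fin c.
have [_ nc] := rlenP fin (rchain_submod c) (rchain_incl c).
by rewrite leqNgt; apply/negP => /(rchain_leq c).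
Qed.

Lemma has_length_rlen S l : is_submod S -> has_length S l ->
  rfinite sub_zero S /\ l = rlen sub_zero S.
Proof.
move=> sS [/(has_chainE _ sS) c nc].
have {}nc : ~ rchain sub_zero S l.+1 by move/(has_chainE _ sS).
have fin : rfinite sub_zero S by exists l.+1.
split=> //; apply/eqP; rewrite eqn_leq rlen_ge //=.
have [c' _] := rlenP fin sS (rchain_incl c).
by rewrite leqNgt; apply/negP => /(rchain_leq c').
Qed.

Lemma rfinite_sub N N' S S' : rfinite N S -> is_submod N' -> is_submod S ->
  sub_incl N N' -> sub_incl S' S -> rfinite N' S'.
Proof.
move=> [n nc] sN' sS NN' S'S; exists n => c; apply: nc; rewrite -[n]add0n.
by apply: rchain_cat (rchain_widen c sS S'S); apply: rchain0.
Qed.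

(** Concatenating maximal chains through [P] gives one inequality; splitting a maximal chain at [P]
    by the modular law gives the other. *)
Lemma rlen_cat N P S : rfinite N S -> is_submod N -> is_submod P ->
  is_submod S -> sub_incl N P -> sub_incl P S ->
  rlen N S = (rlen N P + rlen P S)%N.
Proof.
move=> fin sN sP sS NP PS.
have finP : rfinite N P by apply: rfinite_sub fin sN sS _ PS.
have finS : rfinite P S by apply: rfinite_sub fin sP sS NP _.
have [c1 n1] := rlenP finP sP NP; have [c2 n2] := rlenP finS sS PS.
have [c _] := rlenP fin sS (fun x Nx => PS x (NP x Nx)).
apply/eqP; rewrite eqn_leq (rlen_ge fin (rchain_cat c1 c2)) andbT.
have [a [b [le_ab ca cb]]] := rchain_split_incl sP sS NP PS c.
by rewrite (leq_trans le_ab) // leq_add // rlen_ge.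
Qed.

Lemma rlenxx N : is_submod N -> rlen N N = 0%N.
Proof.
move=> sN; have nc n : ~ rchain N N n.+1.
  by move=> c; inversion c as [|P S k cP sS [PN [x [Nx nPx]]]]; case: nPx; apply: rchain_incl cP _ Nx.
have fin : rfinite N N by exists 1%N; apply: nc.
by have [] := rlenP fin sN (fun x => id); case: rlen => // n /nc.
Qed.

(** * Spans of families and the filtration by initial segments *)

Inductive span (P : M -> Prop) : M -> Prop :=
| span_base x : P x -> span P x
| span0 : span P 0
| spanD x y : span P x -> span P y -> span P (x + y)
| spanZ a x : span P x -> span P (a *: x).

Lemma is_submod_span P : is_submod (span P).
Proof. by split; [exact: span0|exact: spanD|exact: spanZ]. Qed.

Lemma span_min P S : is_submod S -> sub_incl P S -> sub_incl (span P) S.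
Proof. by move=> [S0 SD SZ] PS x; elim=> {x}; auto. Qed.

Lemma span_sub P Q : sub_incl P Q -> sub_incl (span P) (span Q).
Proof. by move=> PQ; apply: span_min => [|x /PQ]; [exact: is_submod_span|exact: span_base]. Qed.

Section SpanFamily.
Variables (J : eqType) (y : J -> M).
Implicit Types (B : J -> Prop) (L : seq J).

Definition span_fam B := span (fun x => exists2 j, B j & x = y j).

Lemma is_submod_span_fam B : is_submod (span_fam B).
Proof. exact: is_submod_span. Qed.

Lemma span_famS B B' : (forall j, B j -> B' j) -> sub_incl (span_fam B) (span_fam B').
Proof. by move=> BB'; apply: span_sub => x [j /BB' Bj ->]; exists j. Qed.

Lemma eq_span_fam B B' : (forall j, B j <-> B' j) -> span_fam B = span_fam B'.
Proof. by move=> BB'; congr span_fam; apply/funext => j; apply/propext. Qed.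

(** Induction from the top of the order: additivity of length splits off the layer of the largest
    index [q]. The layers of smaller indices do not change when [q] is appended, because [q] is
    neither below nor equal to any of them. *)
Lemma rlen_span_sorted (r : rel J) L :
  transitive r -> irreflexive r -> sorted r L ->
  rfinite sub_zero (span_fam (fun j => j \in L)) ->
  rlen sub_zero (span_fam (fun j => j \in L)) =
  (\sum_(q <- L) rlen (span_fam (fun p => (p \in L) && r p q))
     (span_fam (fun p => (p \in L) && (r p q || (p == q)))))%N.
Proof.
move=> rtr rirr; elim/last_ind: L => [|L q IH] Lsort fin.
  rewrite big_nil; have -> : span_fam (fun j => j \in [::]) = sub_zero.
    apply/funext => x; apply/propext; split=> [|->]; last exact: span0.
    by apply: span_min; [exact: is_submod_zero|move=> z []].
  exact/rlenxx/is_submod_zero.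
have Lq : all (r^~ q) L.
  move: Lsort; rewrite -cats1 sorted_pairwise //.
  by rewrite pairwise_cat => /and3P[/allrelP h _ _]; apply/allP => p /h; apply; rewrite mem_head.
have {}Lsort : sorted r L by move: Lsort; rewrite -cats1; apply: (subseq_sorted rtr (prefix_subseq _ _)).
have sub : sub_incl (span_fam (fun j => j \in L)) (span_fam (fun j => j \in rcons L q)).
  by apply: span_famS => j; rewrite mem_rcons inE => ->; rewrite orbT.
have sz P : is_submod P -> sub_incl sub_zero P by move=> [P0 _ _] x ->.
have smf := is_submod_span_fam; have szm := is_submod_zero.
rewrite (rlen_cat (P := span_fam (fun j => j \in L))) //; last exact: sz.
rewrite IH //; last by apply: rfinite_sub fin szm (smf _) _ sub.
rewrite -cats1 big_cat big_seq1 /=; congr (_ + _)%N; last first.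
  congr rlen; apply: eq_span_fam => j; rewrite mem_cat inE.
    have [->|/=] := eqVneq j q; last by rewrite orbF; split=> [h|/andP[]//]; rewrite h (allP Lq).
    by rewrite rirr andbF; split=> // /(allP Lq); rewrite rirr.
  split=> [|/andP[]//] /orP[h|/eqP ->]; last by rewrite !eqxx !orbT.
  by rewrite h (allP Lq).
(* For an earlier [p], the new index [q] satisfies neither [r q p] nor [q == p], so both spans of
   the layer at [p] are unaffected. *)
apply: eq_big_seq => p pL.
have nqp : r q p = false by apply/negP => /(rtr _ _ _ (allP Lq _ pL)); rewrite rirr.
have npq : (q == p) = false by apply/negP => /eqP e; move: (allP Lq _ pL); rewrite e rirr.
congr rlen; apply: eq_span_fam => j; rewrite mem_cat inE.
  by have [->|] := eqVneq j q; rewrite ?nqp ?andbF ?orbF.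
by have [->|] := eqVneq j q; rewrite ?nqp ?npq ?andbF ?orbF.
Qed.

End SpanFamily.
End RelativeLength.

(** * Exponent vectors, Stanley boxes and their generating functions *)

Section Exponents.
Variable m : nat.
Local Notation expo := {ffun 'I_m -> nat}.
Implicit Types (mu nu rho : expo) (al be : {set 'I_m}).

Definition expo_add mu nu : expo := [ffun i => (mu i + nu i)%N].
Definition expo_sub mu nu : expo := [ffun i => (mu i - nu i)%N].
Definition expo_unit (i : 'I_m) : expo := [ffun j => (j == i : nat)].
Definition expo_deg mu : nat := (\sum_i mu i)%N.
Definition expo_wdeg (f : 'I_m -> nat) mu : nat := (\sum_i mu i * f i)%N.
Definition expo_le mu nu := [forall i, (mu i <= nu i)%N].

(* The Stanley box [nu + N^al]. *)
Definition box al nu mu :=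
  expo_le nu mu && [forall i, (i \notin al) ==> (mu i == nu i)].

Lemma boxP al nu mu :
  reflect (forall i, (nu i <= mu i)%N /\ (i \notin al -> mu i = nu i)) (box al nu mu).
Proof.
apply: (iffP andP) => [[/forallP h1 /forallP h2] i|h].
  by split=> // ia; apply/eqP; apply: (implyP (h2 i)).
by split; apply/forallP => i; have [h1 h2] := h i => //; apply/implyP => /h2 ->.
Qed.

(** A point of the box either has the corner's [i]-th coordinate, and lies on the face where [i] is
    frozen, or exceeds it by at least one, and lies in the box shifted by one step along [i]. *)
Lemma box_split be nu mu i : i \in be ->
  (box be nu mu : nat) =
  (box (be :\ i) nu mu + box be (expo_add nu (expo_unit i)) mu)%N.
Proof.
move=> ib; have [hb|nb] := boolP (box be nu mu); last first.
  case: (boxP (be :\ i)) => [h|_]; first case/negP: nb.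
    apply/boxP => j; have [h1 h2] := h j; split=> // jb; apply: h2.
    by rewrite !inE negb_and jb orbT.
  case: boxP => [h|//]; case/negP: nb; apply/boxP => j.
  have [] := h j; rewrite !ffunE; have [->|_] := eqVneq j i; last by rewrite addn0.
  by rewrite ib; split=> //; lia.
have {}hb := boxP _ _ _ hb.
have [e|ne] := eqVneq (mu i) (nu i).
  have -> : box (be :\ i) nu mu.
    apply/boxP => j; have [h1 h2] := hb j; split=> //.
    by rewrite !inE negb_and negbK => /orP[/eqP ->|/h2].
  case: boxP => // /(_ i) []; rewrite !ffunE eqxx e; lia.
have -> : box (be :\ i) nu mu = false.
  by apply/boxP => /(_ i) [_]; rewrite !inE eqxx => /(_ isT) e; rewrite e eqxx in ne.
have -> // : box be (expo_add nu (expo_unit i)) mu.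
apply/boxP => j; have [h1 h2] := hb j; rewrite !ffunE.
have [ej|_] := eqVneq j i; last by rewrite addn0.
by rewrite ej ib in h1 *; split=> //; lia.
Qed.

(* Induction on #|be|, then on the value of [l] at the corner [nu], then on the
   distance from [nu] to a point of the box where [l] is smaller: peeling off
   the face [nu + N^(be - i)] moves the corner one step towards that point. *)
Lemma antitone_boxes (l : expo -> nat) :
  (forall mu nu, expo_le mu nu -> (l nu <= l mu)%N) ->
  forall be nu, exists D : seq ({set 'I_m} * expo),
    forall mu, (box be nu mu * l mu = \sum_(p <- D) box p.1 p.2 mu)%N.
Proof.
move=> l_anti be; have [c] := ubnP #|be|; elim: c be => // c IHc be /ltnSE le_c nu.
have [v] := ubnP (l nu); elim: v nu => // v IHv nu /ltnSE le_v.
have [[mu0 [bmu0 lmu0]]|cst] := pselect (exists mu, box be nu mu /\ (l mu < l nu)%N); last first.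
  (* Here [l] is constant on the box: antitonicity bounds it by [l nu], and no smaller value occurs.
     So [l nu] copies of the box itself suffice. *)
  exists (nseq (l nu) (be, nu)) => mu; rewrite big_nseq iter_addn_0 /=.
  have [bmu|_] := boolP (box be nu mu); rewrite ?mul1n ?mul0n //.
  apply/eqP; rewrite eqn_leq l_anti ?(andP bmu).1 //=.
  by rewrite leqNgt; apply/negP => lt; apply: cst; exists mu.
have {lmu0}lmu0 : (l mu0 < v)%N by apply: leq_trans lmu0 le_v.
have [k] := ubnP (\sum_i (mu0 i - nu i))%N.
elim: k nu bmu0 {le_v} => // k IHk nu bmu0 /ltnSE le_k.
have hb := boxP _ _ _ bmu0.
case: (pickP (fun i => nu i < mu0 i)%N) => [i lt_i|emu]; last first.
  (* The corner has reached [mu0], where [l] takes a value below [v], so the induction on the corner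
     value applies. *)
  apply: IHv; rewrite (_ : nu = mu0) //; apply/ffunP => i.
  by have [h _] := hb i; have /= := emu i; lia.
have ib : i \in be by apply/negPn/negP => /(hb i).2; lia.
have [D1 hD1] : exists D : seq ({set 'I_m} * expo),
    forall mu, (box (be :\ i) nu mu * l mu = \sum_(p <- D) box p.1 p.2 mu)%N.
  by apply: IHc; move: le_c; rewrite (cardsD1 i) ib.
have [] := IHk (expo_add nu (expo_unit i)).
- apply/boxP => j; have [h1 h2] := hb j; rewrite !ffunE.
  have [ej|_] := eqVneq j i; last by rewrite addn0.
  by rewrite ej in h1 h2 *; rewrite ib; split=> //; lia.
- apply: leq_trans le_k; rewrite (bigD1 i) //= [in X in (_ < X)%N](bigD1 i) //=.
  rewrite !ffunE eqxx -addSn leq_add //; first by lia.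
  by apply: leq_sum => j ji; rewrite !ffunE (negbTE ji) addn0.
move=> D2 hD2; exists (D1 ++ D2) => mu.
by rewrite big_cat /= -hD1 -hD2 -mulnDl -box_split.
Qed.

Definition expos_upto B : seq expo :=
  [seq [ffun i => nat_of_ord (k i)] | k : {ffun 'I_m -> 'I_B.+1}].

Lemma mem_expos_upto B mu : (mu \in expos_upto B) = [forall i, (mu i <= B)%N].
Proof.
apply/imageP/forallP => [[k _ ->] i|h]; first by rewrite ffunE -ltnS.
exists [ffun i => inord (mu i)] => //.
by apply/ffunP => i; rewrite !ffunE inordK // ltnS.
Qed.

Lemma expos_upto_uniq B : uniq (expos_upto B).
Proof.
rewrite map_inj_uniq ?enum_uniq // => k1 k2 /ffunP e.
by apply/ffunP => i; apply: val_inj; have := e i; rewrite !ffunE.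
Qed.

Lemma leq_expo_deg mu i : (mu i <= expo_deg mu)%N.
Proof. by rewrite /expo_deg (bigD1 i) //= leq_addr. Qed.

(** The bound ['I_t.+1] on exponents in [geomcoef] loses nothing, since a coordinate never exceeds
    the total degree [t]. For negative [t] there is no exponent vector and [L] is empty. *)
Lemma geomcoef_size f al (t e : int) (L : seq expo) : uniq L ->
  (forall mu, (mu \in L) =
     [&& box al [ffun=> 0%N] mu, (expo_deg mu)%:Z == t & (expo_wdeg f mu)%:Z == e]) ->
  geomcoef f al t e = size L.
Proof.
case: t => t /= Lu Lmem; last by case: L Lu Lmem => // mu L _ /(_ mu); rewrite mem_head andbF.
rewrite cardE -(size_map (fun k : {ffun 'I_m -> 'I_t.+1} => [ffun i => nat_of_ord (k i)] : expo)).
apply/perm_size/uniq_perm => //.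
  rewrite map_inj_uniq ?enum_uniq // => k1 k2 /ffunP ek.
  by apply/ffunP => i; apply: val_inj; have := ek i; rewrite !ffunE.
move=> mu; rewrite Lmem; apply/mapP/and3P => [[k + ->]|].
  rewrite mem_enum inE => /and3P[/forallP h1 h2 h3]; split.
  - by apply/boxP => i; rewrite !ffunE; split=> // ia; apply/eqP/(implyP (h1 i)).
  - by rewrite /expo_deg; under eq_bigr do rewrite ffunE.
  - by rewrite /expo_wdeg; under eq_bigr do rewrite ffunE.
case=> /boxP hb h2 h3.
have ik i : (inord (mu i) : 'I_t.+1) = mu i :> nat.
  by rewrite inordK // ltnS (leq_trans (leq_expo_deg mu i)) //; move: h2; lia.
exists [ffun i => inord (mu i)]; last by apply/ffunP => i; rewrite !ffunE ik.
rewrite mem_enum inE; apply/and3P; split.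
- apply/forallP => i; apply/implyP => ia; rewrite ffunE ik.
  by have [_ /(_ ia)] := hb i; rewrite ffunE => ->.
- by under eq_bigr do rewrite ffunE ik.
- by under eq_bigr do rewrite ffunE ik.
Qed.

Lemma expo_degD mu nu : expo_deg (expo_add mu nu) = (expo_deg mu + expo_deg nu)%N.
Proof. by rewrite /expo_deg -big_split; apply: eq_bigr => i _; rewrite ffunE. Qed.

Lemma expo_wdegD f mu nu :
  expo_wdeg f (expo_add mu nu) = (expo_wdeg f mu + expo_wdeg f nu)%N.
Proof. by rewrite /expo_wdeg -big_split; apply: eq_bigr => i _; rewrite ffunE mulnDl. Qed.

Lemma expo_addK nu mu : expo_sub (expo_add mu nu) nu = mu.
Proof. by apply/ffunP => i; rewrite !ffunE addnK. Qed.

Lemma expo_subK nu mu : expo_le nu mu -> expo_add (expo_sub mu nu) nu = mu.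
Proof. by move/forallP=> h; apply/ffunP => i; rewrite !ffunE subnK. Qed.

Lemma box_addr al nu mu : box al nu (expo_add mu nu) = box al [ffun=> 0%N] mu.
Proof.
apply/boxP/boxP => h i; have := h i; rewrite !ffunE.
  by case=> _ h2; split=> // /h2; lia.
by case=> _ h2; split=> [|/h2 ->]; rewrite ?leq_addl.
Qed.

(** Subtracting the corner [nu] carries the box to the vectors supported on [al], which [geomcoef]
    counts. Cutting coordinates at [B] is harmless because each is at most the total degree
    [n - a]. *)
Lemma sum_box_geomcoef f al nu (a b n d : int) B : (`|n - a|%N <= B)%N ->
  (\sum_(mu <- expos_upto B | ((expo_deg mu)%:Z + a == n)%R && ((expo_wdeg f mu)%:Z + b == d)%R)
     box al nu mu)%N =
  geomcoef f al (n - (a + (expo_deg nu)%:Z)) (d - (b + (expo_wdeg f nu)%:Z)).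
Proof.
move=> leB; rewrite -big_mkcondr -big_filter sum1_size.
set L := filter _ _.
have LP mu : mu \in L -> expo_le nu mu.
  by rewrite mem_filter => /andP[/andP[_ /andP[]]].
rewrite -(size_map (expo_sub^~ nu)); symmetry; apply: geomcoef_size.
  rewrite map_inj_in_uniq ?filter_uniq ?expos_upto_uniq // => mu1 mu2 /LP h1 /LP h2 e.
  by rewrite -(expo_subK h1) -(expo_subK h2) e.
move=> mu.
have -> : (mu \in [seq expo_sub i nu | i <- L]) = (expo_add mu nu \in L).
  apply/mapP/idP => [[k kL ->]|h]; first by rewrite expo_subK ?LP.
  by exists (expo_add mu nu); rewrite ?expo_addK.
rewrite mem_filter mem_expos_upto box_addr expo_degD expo_wdegD.
apply/andP/and3P => [[/andP[/andP[h1 h2] h3] _]|[h1 h2 h3]].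
  by split=> //; lia.
have h4 : ((expo_deg mu + expo_deg nu)%:Z + a == n) by lia.
split; first by rewrite h1 h4 /=; lia.
apply/forallP => i; apply: leq_trans leB.
by apply: leq_trans (leq_expo_deg _ i) _; rewrite expo_degD; lia.
Qed.

End Exponents.

(** * The action of monomials on the module, and translation of the lexicographic order *)

Section MonomialAction.
Variables (A : comPzRingType) (M : lmodType A) (m : nat).
Variables (f2 : 'I_m -> nat) (T : 'I_m -> M -> M) (H : int -> int -> M -> Prop).
Hypothesis T_lin : forall i, lin_endo (T i).
Hypothesis T_comm : forall i j x, T i (T j x) = T j (T i x).
Hypothesis T_deg : forall i n d x, H n d x -> H (n + 1) (d + (f2 i)%:Z) (T i x).
Local Notation expo := {ffun 'I_m -> nat}.
Implicit Types (mu nu : expo) (s : seq 'I_m) (x : M).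

Definition monom_seq s mu x := foldr (fun i z => iter (mu i) (T i) z) x s.
Definition monom mu x := monom_seq (enum 'I_m) mu x.

(** Commutation of the [T i] lets a power of one variable pass through any monomial; this is what
    makes exponents add in [monomD]. *)
Lemma iter_monom_seq i k s mu x :
  iter k (T i) (monom_seq s mu x) = monom_seq s mu (iter k (T i) x).
Proof.
have TT j l z : T i (iter l (T j) z) = iter l (T j) (T i z).
  by elim: l => //= l IH; rewrite T_comm IH.
have T1 z : T i (monom_seq s mu z) = monom_seq s mu (T i z).
  by elim: s => //= j s IH; rewrite TT IH.
by elim: k => //= k ->; rewrite T1.
Qed.

Lemma monomD mu nu x : monom (expo_add mu nu) x = monom nu (monom mu x).
Proof.
rewrite /monom; elim: (enum _) => //= i s IH.
by rewrite ffunE addnC iterD IH -iter_monom_seq.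
Qed.

Lemma monom0 x : monom [ffun=> 0%N] x = x.
Proof. by rewrite /monom; elim: (enum _) => //= i s ->; rewrite ffunE. Qed.

Lemma monom_unit i x : monom (expo_unit i) x = T i x.
Proof.
rewrite /monom; suff -> s : uniq s ->
    monom_seq s (expo_unit i) x = if i \in s then T i x else x.
  by rewrite mem_enum.
  exact: enum_uniq.
elim: s => //= j s IH /andP[js /IH ->]; rewrite inE ffunE [i == j]eq_sym.
by have [e|_] //= := eqVneq j i; rewrite -e (negbTE js).
Qed.

Lemma monom_lin mu : lin_endo (monom mu).
Proof.
rewrite /monom => a x y; elim: (enum _) => //= i s ->.
by elim: (mu i) => //= k ->; rewrite T_lin.
Qed.

Lemma monom_deg mu n d x : H n d x ->
  H ((expo_deg mu)%:Z + n) ((expo_wdeg f2 mu)%:Z + d) (monom mu x).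
Proof.
move=> Hx; rewrite /monom /expo_deg /expo_wdeg -big_enum -[in X in H _ X]big_enum /=.
elim: (enum _) => [|i s IH] /=; first by rewrite !big_nil !add0r.
rewrite !big_cons; elim: (mu i) => [|k IHk] /=; first by rewrite !add0n.
by have := T_deg i IHk; congr (H _ _ _); lia.
Qed.

End MonomialAction.

(** Compatibility of the lexicographic order with multiplication of monomials, stated on exponent
    sequences. *)
Lemma lexi_add2r (s : seq nat) (t u : seq nat) :
  size t = size s -> size u = size s ->
  (([seq p.1 + p.2 | p <- zip t s]%N : seqlexi nat) <
     ([seq p.1 + p.2 | p <- zip u s]%N : seqlexi nat))%O =
  ((t : seqlexi nat) < (u : seqlexi nat))%O.
Proof.
elim: s t u => [|k s IH] [|a t] [|b u] //= [st] [su].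
by rewrite !ltxi_cons IH // !leEnat !leq_add2r.
Qed.

(** * Homogeneous generators and homogeneous components *)

Section HomogeneousGenerators.
Variables (A : comPzRingType) (M : lmodType A) (m : nat).
Variables (f2 : 'I_m -> nat) (T : 'I_m -> M -> M) (H : int -> int -> M -> Prop).
Hypothesis T_lin : forall i, lin_endo (T i).
Hypothesis T_comm : forall i j x, T i (T j x) = T j (T i x).
Hypothesis H_gr : bigraded f2 T H.
Local Notation expo := {ffun 'I_m -> nat}.

Lemma H_submod n d : is_submod (H n d).
Proof. by case: H_gr. Qed.

Lemma homogeneous_generators : fin_gen T -> exists G : seq ((int * int) * M),
  (forall p, p \in G -> H p.1.1 p.1.2 p.2) /\
  (forall x, generated T [seq p.2 | p <- G] x).
Proof.
case=> gs gsP.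
have genS (s s' : seq M) : {subset s <= s'} -> forall x, generated T s x -> generated T s' x.
  move=> ss' x; elim=> {x} [x /ss'||x y _ IHx _ IHy|a x _|i x _];
    [exact: gen_base|exact: gen_zero|exact: gen_add|exact: gen_scale|exact: gen_T].
suff [G [GH Ggen]] : exists G : seq ((int * int) * M),
    (forall p, p \in G -> H p.1.1 p.1.2 p.2) /\
    (forall x, x \in gs -> generated T [seq p.2 | p <- G] x).
  exists G; split=> // x; elim: (gsP x) => {x} [x /Ggen//||x y _ IHx _ IHy|a x _|i x _];
    [exact: gen_zero|exact: gen_add|exact: gen_scale|exact: gen_T].
elim: gs {gsP} => [|g gs [G [GH Ggen]]]; first by exists [::].
case: H_gr => _ /(_ g) [s [_ sH gE]] _ _.
exists (s ++ G); split=> [p|x]; first by rewrite mem_cat => /orP[/sH|/GH].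
rewrite inE => /predU1P[->|/Ggen]; last first.
  by apply: genS => z zG; rewrite map_cat mem_cat zG orbT.
apply: (genS [seq p.2 | p <- s]); first by move=> z zs; rewrite map_cat mem_cat zs.
rewrite {x}gE big_seq; apply: (big_ind (generated T _)).
- exact: gen_zero.
- exact: gen_add.
- by move=> p ps; apply/gen_base/map_f.
Qed.

(** Independence in [bigraded] concerns lists with distinct bidegrees, so the terms of [s] are first
    collected by bidegree into [s']. *)
Lemma homogeneous_sum0 (s : seq ((int * int) * M)) :
  (forall p, p \in s -> H p.1.1 p.1.2 p.2) -> \sum_(p <- s) p.2 = 0 ->
  forall c, \sum_(p <- s | p.1 == c) p.2 = 0.
Proof.
move=> sH s0 c; have [sub add uniqH _] := H_gr.
pose comp c := \sum_(p <- s | p.1 == c) p.2.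
pose s' := [seq (c, comp c) | c <- undup [seq p.1 | p <- s]].
have compH c' : H c'.1 c'.2 (comp c').
  have [h0 hD _] := sub c'.1 c'.2; rewrite /comp big_seq_cond.
  by apply: (big_ind (H c'.1 c'.2)) => // p /andP[/sH + /eqP <-].
have [cs|ncs] := boolP (c \in [seq p.1 | p <- s]); last first.
  rewrite big_seq_cond big_pred0 // => p; apply/negP => /andP[ps /eqP pc].
  by rewrite -pc map_f in ncs.
apply: (uniqH s' _ _ _ (c, comp c)).
- by rewrite -map_comp map_id_in ?undup_uniq.
- by move=> p /mapP[c' _ ->] /=.
- rewrite big_map -[RHS]s0 (exchange_big_dep predT) //=.
  apply: eq_big_seq => p ps; under eq_bigl do rewrite eq_sym.
  by rewrite -big_filter filter_pred1_uniq ?undup_uniq ?mem_undup ?map_f ?big_seq1.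
- by apply/mapP; exists c; rewrite ?mem_undup.
Qed.

(** * The filtration of a component by monomial multiples of generators *)

Variable G : seq ((int * int) * M).
Hypothesis G_hom : forall p, p \in G -> H p.1.1 p.1.2 p.2.
Hypothesis G_gen : forall x, generated T [seq p.2 | p <- G] x.
Hypothesis H_fin : forall n d, rfinite (@sub_zero A M) (H n d).

Implicit Types (p q : nat * expo) (mu nu : expo).
Local Notation gen e := (nth ((0, 0), 0) G e).

Definition gmon q : M := monom T q.2 (gen q.1).2.
Definition bideg q : int * int :=
  ((expo_deg q.2)%:Z + (gen q.1).1.1, (expo_wdeg f2 q.2)%:Z + (gen q.1).1.2).
(** Putting the generator index in front of the exponents makes one lexicographic order compare
    generators first and monomials second. *)
Definition key q : seqlexi nat := q.1 :: [seq q.2 i | i <- enum 'I_m].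
Definition key_lt p q := (key p < key q)%O.
Definition in_bideg c q := (q.1 < size G)%N && (bideg q == c).
Definition below q p := in_bideg (bideg q) p && key_lt p q.
Definition upto q p := in_bideg (bideg q) p && (key_lt p q || (p == q)).
(** The length of the cyclic layer that [gmon q] adds to the span of the smaller monomial multiples
    of the same bidegree. *)
Definition step_len q := rlen (span_fam gmon (below q)) (span_fam gmon (upto q)).

Lemma key_inj : injective key.
Proof.
move=> [e mu] [e' nu] [-> /eq_in_map h]; congr (_, _); apply/ffunP => i.
by apply: h; rewrite mem_enum.
Qed.

Lemma key_ltD e e' mu nu rho :
  key_lt (e, expo_add mu rho) (e', expo_add nu rho) = key_lt (e, mu) (e', nu).
Proof.
(* The leading [0] of the translation vector keeps the generator index fixed. *)
rewrite /key_lt -[RHS](@lexi_add2r (0%N :: [seq rho i | i <- enum 'I_m])) /= ?size_map //.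
rewrite /key /= !addn0.
have h mu' : [seq expo_add mu' rho i | i <- enum 'I_m] =
    [seq (z.1 + z.2)%N | z <- zip [seq mu' i | i <- enum 'I_m] [seq rho i | i <- enum 'I_m]].
  by rewrite zip_map -map_comp; apply: eq_map => i; rewrite ffunE.
by rewrite !h.
Qed.

Lemma bidegD e mu rho : bideg (e, expo_add mu rho) =
  ((expo_deg rho)%:Z + (bideg (e, mu)).1, (expo_wdeg f2 rho)%:Z + (bideg (e, mu)).2).
Proof. by rewrite /bideg /= expo_degD expo_wdegD; congr (_, _); lia. Qed.

Lemma gmonD e mu rho : gmon (e, expo_add mu rho) = monom T rho (gmon (e, mu)).
Proof. exact: monomD. Qed.

Lemma gmon_hom q : (q.1 < size G)%N -> H (bideg q).1 (bideg q).2 (gmon q).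
Proof.
by move=> lt_q; case: H_gr => _ _ _ T_deg; apply: monom_deg => //; apply/G_hom/mem_nth.
Qed.

(** Induction on generation; the essential point is [span_act], by which [T i] carries the monomial
    span of one bidegree into that of the shifted bidegree. *)
Lemma generated_hom x : exists s : seq ((int * int) * M),
  (forall g, g \in s -> span_fam gmon (in_bideg g.1) g.2) /\ x = \sum_(g <- s) g.2.
Proof.
have span_act i c z : span_fam gmon (in_bideg c) z ->
    span_fam gmon (in_bideg (c.1 + 1, c.2 + (f2 i)%:Z)) (T i z).
  have tl := T_lin i.
  have T0 : T i 0 = 0 by have := tl (-1) 0 0; rewrite !scaleN1r !addNr.
  elim=> {z} [_ [[e mu] /andP[/= lt_e /eqP <-] ->]||z z' _ IH _ IH'|a z _ IH].
  - apply: span_base; exists (e, expo_add mu (expo_unit i)).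
      rewrite /in_bideg lt_e bidegD; apply/eqP; congr (_, _); rewrite addrC; congr (_ + _).
        by rewrite /expo_deg (bigD1 i) //= big1 ?ffunE ?eqxx // => j ji; rewrite ffunE (negbTE ji).
      rewrite /expo_wdeg (bigD1 i) //= big1 ?ffunE ?eqxx ?mul1n ?addn0 // => j ji.
      by rewrite ffunE (negbTE ji).
    by rewrite gmonD monom_unit.
  - by rewrite T0; apply: span0.
  - by have := tl 1 z z'; rewrite !scale1r => ->; apply: spanD.
  - by have := tl a z 0; rewrite T0 !addr0 => ->; apply: spanZ.
elim: (G_gen x) => {x} [x /mapP[g gG ->]||x y _ [s [sP ->]] _ [t [tP ->]]|a x _ [s [sP ->]]|i x _ [s [sP ->]]].
- exists [:: g]; rewrite big_seq1; split=> // p; rewrite inE => /eqP ->.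
  apply: span_base; exists (index g G, [ffun=> 0%N]); last by rewrite /gmon /= monom0 nth_index.
  rewrite /in_bideg /bideg /= index_mem gG nth_index //; apply/eqP.
  have -> : expo_deg ([ffun=> 0%N] : expo) = 0%N by apply: big1 => i _; rewrite ffunE.
  have -> : expo_wdeg f2 [ffun=> 0%N] = 0%N by apply: big1 => i _; rewrite ffunE.
  by rewrite !add0r -surjective_pairing.
- by exists [::]; rewrite big_nil.
- exists (s ++ t); rewrite big_cat; split=> // p.
  by rewrite mem_cat => /orP[/sP|/tP].
- exists [seq (g.1, a *: g.2) | g <- s]; rewrite big_map scaler_sumr; split=> //.
  by move=> _ /mapP[p /sP ? ->]; apply: spanZ.
- exists [seq ((g.1.1 + 1, g.1.2 + (f2 i)%:Z), T i g.2) | g <- s]; split.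
    by move=> _ /mapP[p /sP ? ->]; apply: span_act.
  have tl := T_lin i.
  rewrite big_map; elim: s {sP} => [|p s IH]; last first.
    by rewrite !big_cons -IH; have := tl 1 p.2 (\sum_(j <- s) j.2); rewrite !scale1r.
  by rewrite !big_nil; have := tl (-1) 0 0; rewrite !scaleN1r !addNr.
Qed.

Lemma span_in_bideg c : span_fam gmon (in_bideg c) = H c.1 c.2.
Proof.
have sub c' : sub_incl (span_fam gmon (in_bideg c')) (H c'.1 c'.2).
  apply: span_min; first exact: H_submod.
  by move=> _ [q /andP[lt_q /eqP <-] ->]; apply: gmon_hom.
apply/funext => x; apply/propext; split=> [|Hx]; first exact: sub.
have [s [sP xE]] := generated_hom x.
(* Adjoining [- x] in bidegree [c] makes the total vanish. Its part in bidegree [c] then vanishes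
   too, which writes [x] as the sum of the terms of [s] in that bidegree. *)
have /homogeneous_sum0 : forall g, g \in ((c, - x) :: s) -> H g.1.1 g.1.2 g.2.
  move=> p; rewrite inE => /predU1P[->|/sP /sub//].
  by apply: is_submodN => //; apply: H_submod.
rewrite big_cons /= -xE addNr => /(_ erefl c) /eqP; rewrite big_cons /= eqxx.
rewrite addrC subr_eq0 => /eqP <-; rewrite big_seq_cond.
apply: (big_ind (span_fam gmon (in_bideg c))).
- exact: span0.
- exact: spanD.
- by move=> p /andP[/sP + /eqP <-].
Qed.

Lemma span_upto_finite q : rfinite (span_fam gmon (below q)) (span_fam gmon (upto q)).
Proof.
apply: rfinite_sub (H_fin (bideg q).1 (bideg q).2) _ (H_submod _ _) _ _.
- exact: is_submod_span_fam.
- by move=> x ->; apply: span0.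
- by rewrite -span_in_bideg; apply: span_famS => p /andP[].
Qed.

(** With [nu] equal to [mu] plus [rho], multiplication by the monomial of exponent [rho] sends the
    lower span at [mu] into the lower span at [nu] and the top generator to the top generator. It
    therefore induces a surjection of layers, and chains pull back along it. *)
Lemma step_len_anti e mu nu : (e < size G)%N -> expo_le mu nu ->
  (step_len (e, nu) <= step_len (e, mu))%N.
Proof.
move=> lt_e /expo_subK; rewrite (_ : expo_add _ _ = expo_add mu (expo_sub nu mu)); last first.
  by apply/ffunP => i; rewrite !ffunE addnC.
move: (expo_sub nu mu) => rho <-.
have smf B : is_submod (span_fam gmon B) by exact: is_submod_span_fam.
have bu q : sub_incl (span_fam gmon (below q)) (span_fam gmon (upto q)).
  by apply: span_famS => p /andP[h1 h2]; rewrite /upto h1 h2.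
have ml := monom_lin T_lin rho; have m0 : monom T rho 0 = 0.
  by have := ml (-1) 0 0; rewrite !scaleN1r !addNr.
have shift p : below (e, mu) p -> below (e, expo_add mu rho) (p.1, expo_add p.2 rho).
  case: p => e' mu' /andP[/andP[lt_e' /eqP bE] kl]; rewrite /below /in_bideg lt_e' key_ltD kl.
  by rewrite !bidegD bE eqxx.
have [c _] := rlenP (span_upto_finite (e, expo_add mu rho)) (smf _) (@bu _).
apply: rlen_ge; first exact: span_upto_finite.
apply: (rchain_preim ml _ _ _ _ _ _ c) => //.
- move=> x; elim=> {x} [_ [p /shift bp ->]||x y _ IHx _ IHy|a x _ IHx].
  + by apply: span_base; exists (p.1, expo_add p.2 rho); rewrite // gmonD -surjective_pairing.
  + by rewrite m0; apply: span0.
  + by have := ml 1 x y; rewrite !scale1r => ->; apply: spanD.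
  + by have := ml a x 0; rewrite m0 !addr0 => ->; apply: spanZ.
(* Surjectivity modulo the lower span: a strictly smaller generator lifts to [0], the top one to
   [gmon (e, mu)]. *)
- move=> x; elim=> {x} [_ [p /andP[h1 /orP[h2|/eqP ->]] ->]||x y _ [u Su Nu] _ [v Sv Nv]|a x _ [u Su Nu]].
  + exists 0; first exact: span0.
    by rewrite m0 subr0; apply: span_base; exists p => //; apply/andP.
  + exists (gmon (e, mu)); last by rewrite gmonD subrr; apply: span0.
    by apply: span_base; exists (e, mu) => //; rewrite /upto /in_bideg lt_e !eqxx orbT.
  + by exists 0; rewrite ?m0 ?subrr; apply: span0.
  + exists (u + v); first exact: spanD.
    have := ml 1 u v; rewrite !scale1r => ->.
    by rewrite opprD addrACA; apply: spanD.
  + exists (a *: u); first exact: spanZ.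
    by have := ml a u 0; rewrite m0 !addr0 => ->; rewrite -scalerBr; apply: spanZ.
Qed.

Lemma rlen_component n d B :
  (forall e, (e < size G)%N -> (`|n - (gen e).1.1|%N <= B)%N) ->
  rlen (@sub_zero A M) (H n d) =
  (\sum_(e <- iota 0 (size G)) \sum_(mu <- expos_upto m B |
      ((expo_deg mu)%:Z + (gen e).1.1 == n)%R && ((expo_wdeg f2 mu)%:Z + (gen e).1.2 == d)%R)
    step_len (e, mu))%N.
Proof.
move=> BP.
pose L0 := [seq q <- [seq (e, mu) | e <- iota 0 (size G), mu <- expos_upto m B] | bideg q == (n, d)].
pose L := sort (relpre key <=%O) L0.
have Lmem q : (q \in L) = in_bideg (n, d) q.
  rewrite mem_sort mem_filter andbC; apply/andP/andP => [[/allpairsP[[e mu] /= [eG _ ->]] ->]|[lt_q qd]].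
    by move: eG; rewrite mem_iota.
  split=> //; apply/allpairsP; exists (q.1, q.2); split; last exact: surjective_pairing.
    by rewrite mem_iota.
  (* Every variable has first degree one, so the total degree of the monomial is [n] minus the first
     degree of its generator; this bounds each exponent by [B]. *)
  rewrite mem_expos_upto; apply/forallP => i; apply: leq_trans (BP _ lt_q).
  apply: leq_trans (leq_expo_deg _ i) _; case/eqP: qd => <- _; by rewrite addrK.
have Luniq : uniq L.
  rewrite sort_uniq filter_uniq // allpairs_uniq ?iota_uniq ?expos_upto_uniq //.
  by move=> [? ?] [? ?].
have Lsort : sorted key_lt L.
  rewrite /key_lt -[sorted _ _]/(sorted (relpre key <%O) L) -sorted_map lt_sorted_uniq_le.
  rewrite map_inj_uniq ?Luniq /=; last exact: key_inj.
  rewrite sorted_map; apply: sort_sorted => p q; exact: le_total.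
have spanL : span_fam gmon (fun q => q \in L) = H n d.
  by rewrite -(span_in_bideg (n, d)); apply: eq_span_fam => q; rewrite Lmem.
rewrite -spanL (@rlen_span_sorted _ _ _ _ key_lt).
- transitivity (\sum_(q <- L) step_len q)%N.
    apply: eq_big_seq => q; rewrite Lmem => /andP[_ /eqP qd].
    by congr rlen; apply: eq_span_fam => p; rewrite Lmem -qd.
  rewrite (perm_big L0) /=; last by rewrite perm_sort.
  rewrite big_filter big_mkcond /= big_allpairs; apply: eq_bigr => e _.
  by rewrite [RHS]big_mkcond.
- by move=> ? ? ?; apply: lt_trans.
- by move=> q; rewrite /key_lt ltxx.
- exact: Lsort.
- by rewrite spanL.
Qed.

Lemma component_rlen_geomcoef : exists E : seq ({set 'I_m} * (int * int)),
  forall n d, rlen (@sub_zero A M) (H n d) =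
    (\sum_(g <- E) geomcoef f2 g.1 (n - g.2.1)%R (d - g.2.2)%R)%N.
Proof.
have /choice[D DP] e : exists D : seq ({set 'I_m} * expo), (e < size G)%N ->
    forall mu, step_len (e, mu) = (\sum_(g <- D) box g.1 g.2 mu)%N.
  case: (ltnP e (size G)) => lt_e; last by exists [::].
  (* The box with all directions free and corner zero contains every exponent vector. *)
  have [D DP] := antitone_boxes (fun mu nu => @step_len_anti e mu nu lt_e) setT [ffun=> 0%N].
  exists D => _ mu; rewrite -DP; suff -> : box setT [ffun=> 0%N] mu by rewrite mul1n.
  by apply/boxP => i; rewrite ffunE inE.
exists (flatten [seq [seq (g.1, ((gen e).1.1 + (expo_deg g.2)%:Z,
    (gen e).1.2 + (expo_wdeg f2 g.2)%:Z)) | g <- D e] | e <- iota 0 (size G)]) => n d.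
(* A sum of nonnegative terms bounds each of them, so this [B] serves all generators at once. *)
pose B := (\sum_(e < size G) `|n - (gen e).1.1|)%N.
rewrite (@rlen_component n d B); last first.
  by move=> e lt_e; rewrite /B (bigD1 (Ordinal lt_e)) //= leq_addr.
rewrite big_flatten /= big_map; apply: eq_big_seq => e; rewrite mem_iota add0n => /= lt_e.
rewrite [RHS]big_map (eq_bigr _ (fun mu _ => DP e lt_e mu)).
rewrite exchange_big /=; apply: eq_bigr => p _; rewrite sum_box_geomcoef //.
by rewrite /B (bigD1 (Ordinal lt_e)) //= leq_addr.
Qed.

End HomogeneousGenerators.

(** * From the list of boxes to the Laurent polynomials *)

Lemma bigmax_seq_mem (I : eqType) (F : I -> nat) (s : seq I) :
  s != [::] -> exists2 x, x \in s & F x = \max_(y <- s) F y.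
Proof.
elim: s => // a s IH _; have [->|/IH[x xs xE]] := eqVneq s [::].
  by exists a; rewrite ?big_seq1 ?mem_head.
rewrite big_cons /maxn; case: ifP => _; last by exists a; rewrite ?mem_head.
by exists x; rewrite ?inE ?xs ?orbT.
Qed.

(** Taking multiplicities in [E] as coefficients collects equal shifted boxes. By induction on [E],
    each new triple contributes exactly one term of the triple sum. *)
Lemma poinc_rhs_count (m : nat) (f2 : 'I_m -> nat) (h N : nat)
    (E : seq ({set 'I_m} * (int * int))) (n d : int) :
  (forall p, p \in E -> [/\ (#|p.1| <= h)%N, (`|p.2.1|%N <= N)%N & (`|p.2.2|%N <= N)%N]) ->
  poinc_rhs f2 h N (fun al a b => (count_mem (al, (a, b)) E)%:Z) n d =
  (\sum_(p <- E) geomcoef f2 p.1 (n - p.2.1)%R (d - p.2.2)%R)%N%:Z.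
Proof.
elim: E => [_|[be [a b]] E IH EP].
  by rewrite big_nil /poinc_rhs big1 // => al _; rewrite big1 // => i _; rewrite big1.
have [/= hbe ha hb] := EP _ (mem_head _ _).
rewrite big_cons PoszD -IH => [|p pE]; last by apply: EP; rewrite inE pE orbT.
(* An exponent [c] between [-N] and [N] sits at position [c + N] of the summation range. *)
have lt_k (c : int) : (`|c|%N <= N)%N -> (absz (c + N%:Z)%R < (N.*2).+1)%N by lia.
have ordE (c : int) (hc : (`|c|%N <= N)%N) (i : 'I_(N.*2).+1) :
    (c == i%:Z - N%:Z) = (i == Ordinal (lt_k c hc)).
  by rewrite -val_eqE /=; lia.
rewrite /poinc_rhs /=.
have -> : (geomcoef f2 be (n - a) (d - b))%:Z =
  \sum_(al : {set 'I_m} | (#|al| <= h)%N) \sum_(i < (N.*2).+1) \sum_(j < (N.*2).+1)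
    (((be, (a, b)) == (al, (i%:Z - N%:Z, j%:Z - N%:Z))) : nat)%:Z *
      (geomcoef f2 al (n - (i%:Z - N%:Z)) (d - (j%:Z - N%:Z)))%:Z.
  rewrite (bigD1 be) //= [X in _ = _ + X]big1 ?addr0; last first.
    move=> al /andP[_ nal]; rewrite big1 // => i _; rewrite big1 // => j _.
    by rewrite xpair_eqE [be == al]eq_sym (negbTE nal) mul0r.
  rewrite (bigD1 (Ordinal (lt_k a ha))) //= [X in _ = _ + X]big1 ?addr0; last first.
    move=> i ni; rewrite big1 // => j _.
    by rewrite !xpair_eqE (ordE a ha) (negbTE ni) andbF mul0r.
  rewrite (bigD1 (Ordinal (lt_k b hb))) //= [X in _ = _ + X]big1 ?addr0; last first.
    move=> j nj; by rewrite !xpair_eqE (ordE b hb) (negbTE nj) !andbF mul0r.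
  have ea : (absz (a + N%:Z))%:Z - N%:Z = a by lia.
  have eb : (absz (b + N%:Z))%:Z - N%:Z = b by lia.
  by rewrite ea eb eqxx mul1r.
rewrite -big_split; apply: eq_bigr => al _; rewrite -big_split; apply: eq_bigr => i _.
rewrite -big_split; apply: eq_bigr => j _ /=.
by rewrite PoszD mulrDl.
Qed.

Theorem mainTheorem18 (A : comPzRingType) (M : lmodType A) (m : nat)
    (f2 : 'I_m -> nat) (T : 'I_m -> M -> M) (H : int -> int -> M -> Prop) :
  (forall i, lin_endo (T i)) ->
  (forall i j x, T i (T j x) = T j (T i x)) ->
  bigraded f2 T H ->
  fin_gen T ->
  (forall n d : int, exists l : nat, has_length (H n d) l) ->
  exists (h N : nat) (I : {set 'I_m} -> int -> int -> int),
    [/\ (forall (al : {set 'I_m}) (a b : int), (N%:Z < `|a|) || (N%:Z < `|b|) -> I al a b = 0),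
        (forall (n d : int) (l : nat), has_length (H n d) l -> l%:Z = poinc_rhs f2 h N I n d),
        (forall al : {set 'I_m}, #|al| = h -> forall a b : int, 0 <= I al a b) &
        ((exists x : M, x <> 0) ->
           exists al : {set 'I_m}, #|al| = h /\ exists a b : int, I al a b <> 0)].
Proof.
move=> T_lin T_comm H_gr T_fg H_len.
have sH n d : is_submod (H n d) by exact: H_submod H_gr n d.
have H_fin n d : rfinite (@sub_zero A M) (H n d).
  by have [l /(has_length_rlen (sH n d)) []] := H_len n d.
have [G [G_hom G_gen]] := homogeneous_generators H_gr T_fg.
have [E EP] := component_rlen_geomcoef T_lin T_comm H_gr G_hom G_gen H_fin.
(* [h] is the largest dimension of a box in [E] and [N] bounds all its shifts. Coefficients are
   multiplicities, hence nonnegative for every [al]. *)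
exists (\max_(p <- E) #|p.1|)%N, (\max_(p <- E) maxn `|p.2.1| `|p.2.2|)%N.
exists (fun al a b => (count_mem (al, (a, b)) E)%:Z); split.
- move=> al a b hab; apply/eqP; rewrite eqz_nat -leqn0 leqNgt -has_count.
  apply/hasPn => p pE; apply/negP => /eqP pab.
  have : (maxn `|p.2.1| `|p.2.2| <= \max_(p <- E) maxn `|p.2.1| `|p.2.2|)%N.
    exact: leq_bigmax_seq.
  rewrite pab /=; lia.
- move=> n d l /(has_length_rlen (sH n d)) [_ ->]; rewrite EP poinc_rhs_count // => p pE; split.
  + exact: leq_bigmax_seq.
  + exact: leq_trans (leq_maxl _ _) (leq_bigmax_seq _ pE isT).
  + exact: leq_trans (leq_maxr _ _) (leq_bigmax_seq _ pE isT).
- by [].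
move=> [x nx].
(* If [E] were empty, every component would have length zero; but a nonzero homogeneous part of [x]
   gives a chain of length one. Once [E] is nonempty, its maximal dimension is attained. *)
have nE : E != [::].
  apply/eqP => E0; apply: nx.
  case: (H_gr) => _ /(_ x) [s [_ sP ->]] _ _; rewrite big_seq big1 // => p /sP pH.
  apply: contrapT => np.
  have : rchain (@sub_zero A M) (H p.1.1 p.1.2) 1.
    apply: rchainS (rchain0 (is_submod_zero M) (fun x => id)) (sH _ _) _.
    by split=> [z ->|]; [case: (sH p.1.1 p.1.2)|exists p.2].
  by move/(rlen_ge (H_fin _ _)); rewrite EP E0 big_nil.
have [[al [a b]] pE pmax] := bigmax_seq_mem (fun p : {set 'I_m} * (int * int) => #|p.1|) nE.
exists al; split=> //; exists a, b => /eqP; apply/negP.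
by rewrite eqz_nat -lt0n -has_count; apply/hasP; exists (al, (a, b)) => /=.
Qed.
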